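(* Assume $x(0)=x'(0)=0$ and $y_1(t)\to0$ as $t\to\infty$. Let $L_1(t,s)=\omega\sin(\omega(t-s))+\cos(\omega(t-s))$. Then $x(t)\to0$ as $t\to\infty$ if and only if \[ \lim_{t\to\infty}\int_0^tE(t,s)L_1(t,s)y_1(s)\,ds=0. \]
   Context: Standing assumptions: $\omega>0$ is a constant; $p\in C^1([0,\infty))$ with $p(t)>0$ and $p'(t)<0$ for all $t\ge0$, $\int_0^\infty p(t)\,dt=\infty$ and $\int_0^\infty p(t)^2\,dt<\infty$; $f\in L^1_{\mathrm{loc}}([0,\infty))$. $x$ denotes the solution of $x''(t)+p(t)x'(t)+\omega^2x(t)=f(t)$, $t\ge0$. Notation: $E(t,s)=\exp(-\frac12\int_s^tp(\tau)\,d\tau)$ for $0\le s\le t$; $y_1(t)=\int_0^te^{-\omega^2(t-s)}f(s)\,ds$. *)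

(* Defs.v *)
From mathcomp Require Import all_boot all_order all_algebra.
From mathcomp Require Import all_classical all_reals all_analysis.
Set Implicit Arguments. Unset Strict Implicit. Unset Printing Implicit Defensive.
Import Order.TTheory GRing.Theory Num.Theory numFieldNormedType.Exports.
Local Open Scope classical_set_scope.
Local Open Scope ring_scope.

Section Defs.
Variable R : realType.
Local Notation mu := (@lebesgue_measure R).

Definition Efun (p : R -> R) (t s : R) : R :=
  expR (- (2^-1 * (\int[mu]_(tau in `[s, t]) p tau))).

Definition y1 (w : R) (f : R -> R) (t : R) : R :=
  \int[mu]_(s in `[0, t]) (expR (- (w ^+ 2 * (t - s))) * f s).

Definition L1 (w : R) (t s : R) : R :=
  w * sin (w * (t - s)) + cos (w * (t - s)).

(* x solves x'' + p x' + w^2 x = f on [0,oo) with x(0)=a, x'(0)=b,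
   in the Caratheodory sense (f only locally integrable): there is a
   continuous v (= x') with x(t) = a + \int_0^t v and
   v(t) = b + \int_0^t (f - p v - w^2 x). *)
Definition solves_ivp (p : R -> R) (w : R) (f : R -> R) (x : R -> R)
  (a b : R) : Prop :=
  exists v : R -> R,
    {within `[0, +oo[, continuous v} /\
    x 0 = a /\ v 0 = b /\
    (forall t, 0 <= t -> x t = a + \int[mu]_(s in `[0, t]) v s) /\
    (forall t, 0 <= t ->
       v t = b + \int[mu]_(s in `[0, t]) (f s - p s * v s - w ^+ 2 * x s)).

Definition nonneg_half_line : set R := `[0, +oo[.

End Defs.

(* Main.v *)
Require Import Defs.
From mathcomp Require Import all_boot all_order all_algebra.
From mathcomp Require Import all_classical all_reals all_analysis.
From mathcomp Require Import measurable_realfun ring lra.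
Import Order.TTheory GRing.Theory Num.Theory numFieldNormedType.Exports.
Local Open Scope classical_set_scope.
Local Open Scope ring_scope.

(* Subtracting y1 from x' removes the rough forcing: u := x' - y1 is C^1 and
   x' = u + y1, u' = - w^2 x - p u + (w^2 - p) y1.  With e = exp(1/2 \int_0 p),
   variation of constants gives x(t) = \int_0^t E L1 y1 + r(t), where
   r(t) = (1/e(t)) \int_0^t e(s) sin(w(t-s))/w ((p^2/4 + p'/2) x - (p/2) y1) ds.
   The p y1 part of r vanishes since e' = e p / 2, e -> oo and y1 -> 0.  As
   p^2/4 + p'/2 is integrable, the x part vanishes as soon as x is bounded, which
   follows from either side of the equivalence. *)

(** Since f is only locally integrable, neither x' nor y1 need be differentiable everywhere, but
    both carry the same rough part: y1' = f - w^2 y1 almost everywhere. The cancellation of f in u'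
    is therefore carried out on integral equations; afterwards all integrands are continuous and the
    classical fundamental theorem applies. Derivatives are only asserted at t > 0, because functions
    extended by a constant to the left of 0 may have a corner at 0. The exponent 1/2 in e comes from
    the substitution x = z / e, which removes the damping: the homogeneous equation becomes z'' +
    (w^2 - q) z = 0 with q = p^2/4 + p'/2, a perturbation of the harmonic oscillator. Its
    integrability has two sources: p^2 is integrable by assumption, and p' has constant sign, so the
    integral of |p'| telescopes and is at most p(0). The delicate direction starts from the kernel
    integral: the estimate of r needs a bound on x, which has to be extracted from that same
    estimate. *)

Section interval_integrals.
Set Implicit Arguments. Unset Strict Implicit.
Context {R : realType}.
Notation mu := (@lebesgue_measure R).
Implicit Types (f g h : R -> R) (a b c t : R).

Lemma continuous_integrable_itv g a b : continuous g ->
  mu.-integrable `[a, b] (EFin \o g).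
Proof.
move=> cg; apply: continuous_compact_integrable; first exact: segment_compact.
exact: continuous_subspaceT.
Qed.

Lemma integrable_subitv g a b c d : a <= c -> d <= b ->
  mu.-integrable `[a, b] (EFin \o g) -> mu.-integrable `[c, d] (EFin \o g).
Proof.
move=> ac db; apply: integrableS => //= z /=; rewrite !in_itv/= => /andP[cz zd].
by rewrite (le_trans ac)// (le_trans zd).
Qed.

Lemma Rintegral_chasles g a b c : a <= b -> b <= c ->
  mu.-integrable `[a, c] (EFin \o g) ->
  \int[mu]_(s in `[a, c]) g s =
  \int[mu]_(s in `[a, b]) g s + \int[mu]_(s in `[b, c]) g s.
Proof.
move=> ab bc ig; have ibc : mu.-integrable `]b, c] (EFin \o g).
  apply: integrableS ig => //= z /=; rewrite !in_itv/= => /andP[cz ->].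
  by rewrite andbT (le_trans ab)// ltW.
have := @Rintegral_itvB _ g (BLeft a) (BRight c) b ig; rewrite !bnd_simp.
move=> /(_ ab bc) E; rewrite -(@Rintegral_itv_obnd_cbnd _ b (BRight c) g ibc) addrC.
exact: (canRL (subrK _) E).
Qed.

Lemma continuous_bounded_itv g a b : continuous g ->
  exists2 M, 0 < M & forall t, a <= t -> t <= b -> `|g t| <= M.
Proof.
move=> cg; have [ab|ba] := leP a b; last first.
  by exists 1 => // t at_ tb; have := le_trans at_ tb; rewrite leNgt ba.
have cng : continuous (fun t => `|g t|).
  by move=> z; apply: continuous_comp; [exact: cg|exact: norm_continuous].
have [c _ cmax] := @EVT_max _ (fun t => `|g t|) a b ab (continuous_subspaceT cng).
exists (`|g c| + 1); first by rewrite ltr_wpDl.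
move=> t at_ tb; have : t \in `[a, b]%R by rewrite in_itv/= at_.
by move=> /cmax/le_trans; apply; rewrite lerDl.
Qed.

(** A continuous factor is bounded on a compact interval. This is how the merely integrable [f]
    receives its exponential weight. *)
Lemma integrable_itvMl h g a b : continuous h ->
  mu.-integrable `[a, b] (EFin \o g) ->
  mu.-integrable `[a, b] (EFin \o (fun s => h s * g s)).
Proof.
move=> ch ig; have [M M0 hM] := @continuous_bounded_itv h a b ch.
apply: (@integrableMr _ _ _ mu _ _ h (EFin \o g)) => //.
- exact: (subspace_continuous_measurable_fun _ (continuous_subspaceT ch)).
- exists M; split; first by rewrite num_real.
  move=> K MK z /=; rewrite in_itv/= => /andP[az zb].
  by rewrite (le_trans (hM z az zb))// ltW.
Qed.

Lemma is_derive_Rintegral g a t : continuous g -> a < t ->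
  is_derive t (1 : R) (fun z => \int[mu]_(s in `[a, z]) g s) (g t).
Proof.
move=> cg at_.
(* The right end [t + 1] only serves to make [t] an interior point. *)
have [] := @continuous_FTC1_closed _ g a t (t + 1).
- by rewrite ltrDl.
- exact: continuous_integrable_itv.
- exact: at_.
- exact: cg.
move=> d1 d2; apply: DeriveDef => //.
by rewrite -derive1E.
Qed.

Lemma Rintegral_FTC2 (F G : R -> R) a b : a <= b -> continuous F -> continuous G ->
  (forall s, a < s -> s < b -> is_derive s (1 : R) F (G s)) ->
  \int[mu]_(s in `[a, b]) G s = F b - F a.
Proof.
rewrite le_eqVlt => /predU1P[->|ab] cF cG dF.
  by rewrite set_itv1 Rintegral_set1 subrr.
rewrite /Rintegral (@continuous_FTC2 _ G F)//.
- exact: continuous_subspaceT.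
- split.
  + by move=> s /[!in_itv]/= /andP[as_ sb]; case: (dF s as_ sb).
  + exact/cvg_at_right_filter/cF.
  + exact/cvg_at_left_filter/cF.
- move=> s /[!in_itv]/= /andP[as_ sb]; rewrite derive1E.
  by case: (dF s as_ sb).
Qed.

Lemma normr_Rintegral_le g h a b :
  mu.-integrable `[a, b] (EFin \o g) -> mu.-integrable `[a, b] (EFin \o h) ->
  (forall s, a <= s -> s <= b -> `|g s| <= h s) ->
  `|\int[mu]_(s in `[a, b]) g s| <= \int[mu]_(s in `[a, b]) h s.
Proof.
move=> ig ih gh; apply: (le_trans (le_normr_Rintegral _ ig)) => //.
apply: le_Rintegral => //.
- by move/integrable_norm: ig.
- by move=> s /=; rewrite in_itv/= => /andP[]; exact: gh.
Qed.

(* Turns data controlled only on [0, +oo[ into functions continuous on the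
   whole line, which avoids subspace topologies. *)
Definition clamp (F : R -> R) t := F (Num.max 0 t).

Lemma clampE F t : 0 <= t -> clamp F t = F t.
Proof. by move=> t0; rewrite /clamp max_r. Qed.

Lemma continuous_clamp (F : R -> R) :
  (forall T, 0 < T -> {within `[0, T], continuous F}) -> continuous (clamp F).
Proof.
move=> cF t; pose T : R := Num.max 0 t + 1.
have T0 : 0 < T by rewrite ltr_wpDl// le_max lexx.
have tT : t < T by rewrite (@le_lt_trans _ _ (Num.max 0 t)) ?ltrDl// le_max lexx orbT.
have mt : `[0, T]%classic (Num.max 0 t) by rewrite /= in_itv/= le_max lexx/= lerDl.
have /subspace_continuousP/(_ _ mt) cFt := cF T T0.
have cm : {for t, continuous (fun z : R => Num.max 0 z)}.
  by apply: max_fun_continuous; [exact: cst_continuous|move=> ?; exact: cvg_id].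
apply/cvgrPdist_lt => e e0.
move/cvgrPdist_lt : cFt => /(_ e e0); rewrite /within/= => H.
have H' := cm _ H.
near=> z.
have : `[0, T]%classic (Num.max 0 z) -> `|F (Num.max 0 t) - clamp F z| < e.
  by near: z; exact: H'.
apply.
rewrite /= in_itv/= le_max lexx/= ge_max ltW//=.
by apply/ltW; near: z; exact: lt_nbhsl.
Unshelve. all: by end_near. Qed.

End interval_integrals.

(** * Integration by parts with an absolutely continuous factor *)

Section product_rule.
Set Implicit Arguments. Unset Strict Implicit.
Context {R : realType}.
Notation mu := (@lebesgue_measure R).

Lemma integrable_itvD (g h : R -> R) a b :
  mu.-integrable `[a, b] (EFin \o g) -> mu.-integrable `[a, b] (EFin \o h) ->
  mu.-integrable `[a, b] (EFin \o (fun s => g s + h s)).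
Proof. by move=> ig ih; exact: (integrableD _ ig ih). Qed.

Lemma integrable_itvB (g h : R -> R) a b :
  mu.-integrable `[a, b] (EFin \o g) -> mu.-integrable `[a, b] (EFin \o h) ->
  mu.-integrable `[a, b] (EFin \o (fun s => g s - h s)).
Proof. by move=> ig ih; exact: (integrableB _ ig ih). Qed.

Lemma Rintegral_itv_cst (c a b : R) : a <= b ->
  \int[mu]_(s in `[a, b]) c = c * (b - a).
Proof.
move=> ab; have E : lebesgue_measure (`[a, b]%classic : set R) = (b - a)%:E.
  rewrite lebesgue_measure_itv/= lte_fin; case: ltP => // ba.
  have -> : a = b by apply/eqP; rewrite eq_le ab ba.
  by rewrite subrr.
by rewrite -[b - a]/(fine (b - a)%:E) -E; exact: Rintegral_cst.
Qed.

(* Cut [0, T] into n equal parts and let n tend to infinity. *)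
Lemma eq_of_quadratic_increments (D m : R -> R) K T : 0 <= T ->
  (forall a b, 0 <= a -> a <= b -> b <= T ->
    `|D b - D a| <= K * (b - a) * (m b - m a)) -> D T = D 0.
Proof.
move=> T0 H; pose C := K * T * (m T - m 0).
(* On a uniform partition each increment costs K T / n.+1 times an increment of [m]; the latter
   telescope, so the total error is [C / n.+1]. *)
have bnd n : `|D T - D 0| <= C / n.+1%:R.
  pose t (i : nat) : R := i%:R * (T / n.+1%:R).
  have n0 : (0 : R) < n.+1%:R by rewrite ltr0n.
  have tT : t n.+1 = T by rewrite /t mulrC divfK// gt_eqF.
  have t0 : t 0%N = 0 by rewrite /t mul0r.
  have dt i : t i.+1 - t i = T / n.+1%:R by rewrite /t -mulrBl -natrB// subSnn mul1r.
  have step i : (i < n.+1)%N ->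
      `|D (t i.+1) - D (t i)| <= K * (T / n.+1%:R) * (m (t i.+1) - m (t i)).
    move=> ilt; rewrite -(dt i); apply: H.
    - by rewrite mulr_ge0// divr_ge0// ltW.
    - by rewrite -subr_ge0 dt divr_ge0// ltW.
    - by rewrite -tT /t; apply: ler_wpM2r; [rewrite divr_ge0// ltW|rewrite ler_nat].
  have -> : D T - D 0 = \sum_(0 <= i < n.+1) (D (t i.+1) - D (t i)).
    by rewrite (telescope_sumr (fun i => D (t i)))// tT t0.
  apply: (le_trans (ler_norm_sum _ _ _)).
  have -> : C / n.+1%:R =
      \sum_(0 <= i < n.+1) K * (T / n.+1%:R) * (m (t i.+1) - m (t i)).
    rewrite -mulr_sumr (telescope_sumr (fun i => m (t i)))// tT t0.
    by rewrite /C; ring.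
  by rewrite !big_mkord; apply: ler_sum => i _; apply: step.
apply/eqP; rewrite -subr_eq0 -normr_eq0; apply/negPn/negP => d0.
have dp : 0 < `|D T - D 0| by rewrite lt_neqAle eq_sym d0 normr_ge0.
(* This number of parts makes [C / n.+1] smaller than the supposed nonzero difference. *)
have := bnd (Num.truncn (C / `|D T - D 0|)).
apply/negP; rewrite -ltNge ltr_pdivrMr ?ltr0n// mulrC -ltr_pdivrMr//.
exact: truncnS_gt.
Qed.

(* [G] is only absolutely continuous, so the classical integration by parts does
   not apply: the defect of the identity has increments over [a, b] of order
   [(b - a) * \int_a^b |g|]. *)
Lemma Rintegral_product_rule (phi dphi g G : R -> R) T : 0 <= T ->
  continuous phi -> continuous dphi ->
  (forall s, is_derive s (1 : R) phi (dphi s)) ->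
  mu.-integrable `[0, T] (EFin \o g) -> continuous G ->
  (forall t, 0 <= t -> t <= T -> G t = \int[mu]_(s in `[0, t]) g s) ->
  phi T * G T = \int[mu]_(s in `[0, T]) (dphi s * G s + phi s * g s).
Proof.
move=> T0 cphi cdphi dphiE ig cG GE.
have ing : mu.-integrable `[0, T] (EFin \o (fun s => `|g s|)).
  exact: integrable_norm ig.
have cdG : continuous (fun s => dphi s * G s).
  by move=> z; apply: cvgM; [exact: cdphi|exact: cG].
have iH : mu.-integrable `[0, T] (EFin \o (fun s => dphi s * G s + phi s * g s)).
  by apply: integrable_itvD; [exact: continuous_integrable_itv|exact: integrable_itvMl].
have [M M0 HM] := @continuous_bounded_itv _ dphi 0 T cdphi.
pose m t := \int[mu]_(s in `[0, t]) `|g s|.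
pose D t := phi t * G t - \int[mu]_(s in `[0, t]) (dphi s * G s + phi s * g s).
have G0 : G 0 = 0 by rewrite GE// set_itv1 Rintegral_set1.
suff : D T = D 0.
  rewrite /D G0 mulr0 set_itv1 Rintegral_set1 subr0 => /eqP.
  by rewrite subr_eq0 => /eqP.
(* The factor 2 counts two error terms, one from the variation of [G] and one from that of [phi],
   each at most M (b - a) (m b - m a). *)
apply: (@eq_of_quadratic_increments D m (2 * M)) => // a b a0 ab bT.
have b0 : 0 <= b := le_trans a0 ab.
have aT : a <= T := le_trans ab bT.
have sub (h : R -> R) c d : 0 <= c -> d <= T -> mu.-integrable `[0, T] (EFin \o h) ->
    mu.-integrable `[c, d] (EFin \o h) by exact: integrable_subitv.
have incr (h : R -> R) c d : 0 <= c -> c <= d -> d <= T ->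
    mu.-integrable `[0, T] (EFin \o h) ->
    \int[mu]_(s in `[0, d]) h s - \int[mu]_(s in `[0, c]) h s =
    \int[mu]_(s in `[c, d]) h s.
  move=> c0 cd dT ih; rewrite (@Rintegral_chasles _ h 0 c d)//; last exact: sub.
  by rewrite addrAC subrr add0r.
have dphiI c d : c <= d -> phi d - phi c = \int[mu]_(s in `[c, d]) dphi s.
  by move=> cd; rewrite (@Rintegral_FTC2 _ phi dphi).
set Del := m b - m a.
have DelE : Del = \int[mu]_(s in `[a, b]) `|g s| by rewrite /Del /m incr.
have Gs s : a <= s -> s <= b -> `|G b - G s| <= Del.
  move=> as_ sb; rewrite !GE ?(le_trans a0 as_) ?(le_trans sb bT)//.
  rewrite incr ?(le_trans a0 as_)//.
  rewrite (@le_trans _ _ (\int[mu]_(z in `[s, b]) `|g z|))//.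
    by apply: normr_Rintegral_le => //; apply: sub => //; exact: le_trans as_.
  rewrite DelE (@Rintegral_chasles _ (fun s => `|g s|) a s b)//; last exact: sub.
  by rewrite lerDr Rintegral_ge0.
have phis s : a <= s -> s <= b -> `|phi a - phi s| <= M * (b - a).
  move=> as_ sb; rewrite distrC dphiI//.
  apply: (@le_trans _ _ (\int[mu]_(z in `[a, s]) M)).
    apply: normr_Rintegral_le; [exact: continuous_integrable_itv| |].
      by apply: continuous_integrable_itv; exact: cst_continuous.
    by move=> z az zs; apply: HM; [exact: le_trans az|exact: le_trans (le_trans sb bT)].
  by rewrite Rintegral_itv_cst// ler_wpM2l ?(ltW M0)// lerB.
have c1 : continuous (fun s => dphi s * (G b - G s)).
  move=> z; apply: cvgM; first exact: cdphi.
  by apply: cvgB; [exact: cvg_cst|exact: cG].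
have c2 : continuous (fun s => phi a - phi s).
  by move=> z; apply: cvgB; [exact: cvg_cst|exact: cphi].
have igab : mu.-integrable `[a, b] (EFin \o g) by exact: sub.
have ingab : mu.-integrable `[a, b] (EFin \o (fun s => `|g s|)) by exact: sub.
(* Write phi(b) G(b) - phi(a) G(a) as G(b) (phi(b) - phi(a)) + phi(a) (G(b) - G(a)) and both
   differences as integrals. Each term of the integrand then contains a small difference. *)
have -> : D b - D a =
    \int[mu]_(s in `[a, b]) (dphi s * (G b - G s) + (phi a - phi s) * g s).
  have i1 : mu.-integrable `[a, b] (EFin \o (fun s => G b * dphi s)).
    apply: continuous_integrable_itv => z; apply: cvgM; [exact: cvg_cst|exact: cdphi].
  have i2 : mu.-integrable `[a, b] (EFin \o (fun s => phi a * g s)).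
    by apply: integrable_itvMl => //; exact: cst_continuous.
  transitivity (\int[mu]_(s in `[a, b]) ((G b * dphi s + phi a * g s)
     - (dphi s * G s + phi s * g s))); last first.
    by apply: eq_Rintegral => s _; ring.
  rewrite RintegralB//; [|exact: integrable_itvD|exact: sub].
  rewrite RintegralD// !RintegralZl//; last exact: continuous_integrable_itv.
  rewrite -dphiI// -(incr g)// -(incr (fun s => dphi s * G s + phi s * g s))//.
  rewrite -!GE// /D; ring.
apply: (@le_trans _ _ (\int[mu]_(s in `[a, b]) (M * Del + M * (b - a) * `|g s|))).
  apply: normr_Rintegral_le.
  - apply: integrable_itvD; [exact: continuous_integrable_itv|exact: integrable_itvMl].
  - apply: integrable_itvD.
      by apply: continuous_integrable_itv; exact: cst_continuous.
    by apply: integrable_itvMl => //; exact: cst_continuous.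
  - move=> s as_ sb; apply: (le_trans (ler_normD _ _)); rewrite !normrM.
    apply: lerD; last by rewrite ler_wpM2r// phis.
    by apply: ler_pM => //; [apply: HM; [exact: le_trans as_|exact: le_trans bT]|exact: Gs].
rewrite RintegralD//; first last.
- by apply: integrable_itvMl => //; exact: cst_continuous.
- by apply: continuous_integrable_itv; exact: cst_continuous.
rewrite Rintegral_itv_cst// RintegralZl// -DelE le_eqVlt; apply/orP; left; apply/eqP; ring.
Qed.

End product_rule.

(** * Integrating factor and variation of constants *)

Section duhamel.
Set Implicit Arguments. Unset Strict Implicit.
Context {R : realType}.
Notation mu := (@lebesgue_measure R).
Implicit Types F G : R -> R.

Lemma continuous_funD F G : continuous F -> continuous G ->
  continuous (fun z => F z + G z).
Proof. by move=> cF cG z; apply: cvgD; [exact: cF|exact: cG]. Qed.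

Lemma continuous_funB F G : continuous F -> continuous G ->
  continuous (fun z => F z - G z).
Proof. by move=> cF cG z; apply: cvgB; [exact: cF|exact: cG]. Qed.

Lemma continuous_funM F G : continuous F -> continuous G ->
  continuous (fun z => F z * G z).
Proof. by move=> cF cG z; apply: cvgM; [exact: cF|exact: cG]. Qed.

Lemma continuous_funZ F (c : R) : continuous F -> continuous (fun z => c * F z).
Proof. by move=> cF z; apply: cvgM; [exact: cvg_cst|exact: cF]. Qed.

Lemma continuous_fun_norm F : continuous F -> continuous (fun z => `|F z|).
Proof.
by move=> cF z; apply: continuous_comp; [exact: cF|exact: norm_continuous].
Qed.

Lemma is_derive_add F G (s a b : R) : is_derive s (1 : R) F a ->
  is_derive s (1 : R) G b -> is_derive s (1 : R) (fun z => F z + G z) (a + b).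
Proof. by move=> dF dG; exact: is_deriveD. Qed.

Lemma is_derive_mul F G (s a b : R) : is_derive s (1 : R) F a ->
  is_derive s (1 : R) G b ->
  is_derive s (1 : R) (fun z => F z * G z) (a * G s + F s * b).
Proof.
move=> dF dG; apply: (is_derive_eq (is_deriveM dF dG)).
by rewrite addrC; congr (_ + _); exact: mulrC.
Qed.

Lemma is_derive_scale F (c s a : R) : is_derive s (1 : R) F a ->
  is_derive s (1 : R) (fun z => c * F z) (c * a).
Proof. by move=> dF; exact: is_deriveZ. Qed.

Lemma is_derive_clamp F (t l : R) : 0 < t -> is_derive t (1 : R) F l ->
  is_derive t (1 : R) (clamp F) l.
Proof.
move=> t0; apply: near_eq_is_derive; near=> z; rewrite clampE//.
by apply: ltW; near: z; exact: lt_nbhsr.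
Unshelve. all: by end_near. Qed.

(** Equal to 1 on the negative half-line; the clamp makes it continuous on the whole line. *)
Definition integrating_factor (p : R -> R) :=
  fun t => expR (2^-1 * clamp (fun z => \int[mu]_(s in `[0, z]) p s) t).

Lemma continuous_clamp_Rintegral (p : R -> R) :
  (forall T, 0 < T -> mu.-integrable `[0, T] (EFin \o p)) ->
  continuous (clamp (fun z => \int[mu]_(s in `[0, z]) p s)).
Proof.
move=> ip; apply: continuous_clamp => T T0.
by apply: parameterized_integral_continuous; [exact: ltW|exact: ip].
Qed.

Lemma continuous_integrating_factor (p : R -> R) : continuous p ->
  continuous (integrating_factor p).
Proof.
move=> cp z; apply: continuous_comp; last exact: continuous_expR.
apply: cvgM; first exact: cvg_cst.
by apply: continuous_clamp_Rintegral => T _; exact: continuous_integrable_itv.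
Qed.

Lemma is_derive_integrating_factor (p : R -> R) (t : R) : continuous p -> 0 < t ->
  is_derive t (1 : R) (integrating_factor p) (2^-1 * p t * integrating_factor p t).
Proof.
move=> cp t0; rewrite /integrating_factor.
pose P := clamp (fun z => \int[mu]_(s in `[0, z]) p s).
have dP : is_derive t (1 : R) P (p t).
  exact/is_derive_clamp/is_derive_Rintegral.
have dP2 : is_derive t (1 : R) (fun z => 2^-1 * P z) (2^-1 * p t).
  exact: is_derive_scale.
rewrite mulrC; exact: (is_derive1_comp (is_derive_expR _) dP2).
Qed.

(** Separating the two variables of the kernel lets the factor in [t] leave the integral over
    [s]. *)
Lemma Efun_integrating_factor (p : R -> R) (t s : R) : continuous p -> 0 <= s -> s <= t ->
  Efun p t s = (integrating_factor p t)^-1 * integrating_factor p s.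
Proof.
move=> cp s0 st; have t0 := le_trans s0 st.
rewrite /Efun /integrating_factor !clampE// -expRN -expRD; congr expR.
rewrite (@Rintegral_chasles _ p 0 s t)//; last exact: continuous_integrable_itv.
ring.
Qed.

Context (w : R) (p dp x u y : R -> R).
Context (w0 : 0 < w) (cp : continuous p) (cdp : continuous dp)
  (cx : continuous x) (cu : continuous u) (cy : continuous y).
Context (Dp : forall t : R, 0 < t -> is_derive t (1 : R) p (dp t))
  (Dx : forall t : R, 0 < t -> is_derive t (1 : R) x (u t + y t))
  (Du : forall t : R, 0 < t -> is_derive t (1 : R) u
     (- (w ^+ 2 * x t) - p t * u t + (w ^+ 2 - p t) * y t)).
Context (x0 : x 0 = 0) (u0 : u 0 = 0).

Let q t := p t * p t / 4 + dp t / 2.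

Lemma continuous_rotation (F : R -> R) (t : R) : continuous F ->
  continuous (fun s => F (w * (t - s))).
Proof.
move=> cF z; apply: continuous_comp; last exact: cF.
apply: cvgM; first exact: cvg_cst.
by apply: cvgB; [exact: cvg_cst|exact: cvg_id].
Qed.

Lemma is_derive_rotation (F : R -> R) (t s l : R) :
  is_derive (w * (t - s)) (1 : R) F l ->
  is_derive s (1 : R) (fun z => F (w * (t - z))) (- w * l).
Proof.
move=> dF.
have dr : is_derive s (1 : R) (fun z : R => w * (t - z)) (- w).
  rewrite -mulrN1; apply: (@is_derive_scale (fun z => t - z)).
  rewrite -[-1]add0r; apply: (@is_derive_add (cst t) (fun z => - z)).
rewrite [- w * l]mulrC.
exact: (@is_derive1_comp _ F (fun z : R => w * (t - z)) s _ _ dF dr).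
Qed.

Lemma continuous_damping_defect : continuous q.
Proof.
apply: continuous_funD.
  by move=> z; apply: cvgM; [apply: cvgM; exact: cp|exact: cvg_cst].
by move=> z; apply: cvgM; [exact: cdp|exact: cvg_cst].
Qed.

Let e := integrating_factor p.
Let ce : continuous e := continuous_integrating_factor cp.

(* Integrate over [0, T] the derivative of
   e(s) (cos(w(T-s)) x(s) + sin(w(T-s))/w (u(s) + p(s) x(s)/2)). *)
Lemma duhamel_formula (T : R) : 0 <= T ->
  x T = \int[mu]_(s in `[0, T]) (Efun p T s * L1 w T s * y s) +
    (e T)^-1 * \int[mu]_(s in `[0, T])
      (e s * (sin (w * (T - s)) / w * (q s * x s - p s / 2 * y s))).
Proof.
move=> T0.
have eT : e T != 0 by rewrite gt_eqF// expR_gt0.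
have csin := @continuous_rotation sin T (@continuous_sin R).
have ccos := @continuous_rotation cos T (@continuous_cos R).
pose W s := e s * (cos (w * (T - s)) * x s +
  (w^-1 * sin (w * (T - s))) * (u s + 2^-1 * (p s * x s))).
pose main s := e s * (L1 w T s * y s).
pose rem s := e s * (sin (w * (T - s)) / w * (q s * x s - p s / 2 * y s)).
have cmain : continuous main.
  have cL : continuous (L1 w T) := continuous_funD (continuous_funZ (c:=w) csin) ccos.
  exact: (continuous_funM ce (continuous_funM cL cy)).
have crem : continuous rem.
  apply: (continuous_funM ce); apply: continuous_funM.
    by move=> z; apply: cvgM; [exact: csin|exact: cvg_cst].
  apply: (continuous_funB (continuous_funM continuous_damping_defect cx)).
  apply: (fun H => continuous_funM H cy) => z.
  by apply: cvgM; [exact: cp|exact: cvg_cst].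
have cW : continuous W.
  apply: (continuous_funM ce); apply: (continuous_funD (continuous_funM ccos cx)).
  apply: (continuous_funM (continuous_funZ (c:=w^-1) csin)); apply: (continuous_funD cu).
  exact: (continuous_funZ (c:=2^-1) (continuous_funM cp cx)).
have cW' : continuous (fun s => main s + rem s).
  exact: continuous_funD.
have dW s : 0 < s -> s < T -> is_derive s (1 : R) W (main s + rem s).
  move=> s0 _.
  have dcos := is_derive_rotation (is_derive_cos (w * (T - s))).
  have dsin := is_derive_rotation (is_derive_sin (w * (T - s))).
  have dsin' := is_derive_scale w^-1 dsin.
  have dpx := is_derive_scale 2^-1 (is_derive_mul (Dp s0) (Dx s0)).
  have de := is_derive_integrating_factor cp s0.
  (* All terms in [u] cancel: those with cosine against the derivative of the sine, those with sine
     because p/2 - p + p/2 = 0. The terms in [x] leave q sin/w. In those with [y], cos + (w^2 - p +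
     p/2) sin/w is [L1] minus (p/2) sin/w. *)
  apply: (is_derive_eq (is_derive_mul de (is_derive_add (is_derive_mul dcos (Dx s0))
    (is_derive_mul dsin' (is_derive_add (Du s0) dpx))))).
  rewrite /main /rem /L1 /q -/(e s) /cst /=; field.
  by rewrite gt_eqF.
have W0 : W 0 = 0.
  rewrite /W x0 u0; move: (e 0) (p 0) (cos _) (sin _) => a b c d; ring.
have WT : W T = e T * x T.
  rewrite /W subrr mulr0 cos0 sin0.
  move: (e T) (x T) (u T) (p T) => a b c d; ring.
have := Rintegral_FTC2 T0 cW cW' dW.
rewrite W0 WT subr0 RintegralD//; [|exact: continuous_integrable_itv..].
have -> : \int[mu]_(s in `[0, T]) (Efun p T s * L1 w T s * y s) =
    (e T)^-1 * \int[mu]_(s in `[0, T]) main s.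
  rewrite -RintegralZl//; last exact: continuous_integrable_itv.
  apply: eq_Rintegral => s; rewrite inE/= in_itv/= => /andP[s0 sT].
  by rewrite Efun_integrating_factor// /main !mulrA.
move: eT; move: (e T) (x T) => c d c0 eqW.
transitivity (c^-1 * (c * d)); first by rewrite mulKf.
by rewrite -eqW mulrDr.
Qed.

End duhamel.

(** * Averages against an increasing unbounded weight *)

Section weighted_averages.
Set Implicit Arguments. Unset Strict Implicit.
Context {R : realType}.
Notation mu := (@lebesgue_measure R).
Implicit Types g h r : R -> R.

(** Convergence to 0 at infinity with a nonnegative threshold, so that functions compared only on
    [0, +oo[ can be exchanged directly. *)
Definition vanishes g := forall eps : R, 0 < eps ->
  exists2 T, 0 <= T & forall t, T <= t -> `|g t| <= eps.

Lemma cvg_vanishesP g : (g t @[t --> +oo] --> (0 : R)) <-> vanishes g.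
Proof.
split=> [/cvgr0Pnorm_le H eps eps0|H].
  have [T [_ HT]] := H eps eps0.
  exists (Num.max 0 (T + 1)); first by rewrite le_max lexx.
  move=> t; rewrite ge_max => /andP[_ Tt]; apply: HT.
  by rewrite (lt_le_trans _ Tt)// ltrDl.
apply/cvgr0Pnorm_le => eps eps0; have [T _ HT] := H eps eps0.
by exists T; split; [exact: num_real|move=> t /ltW; exact: HT].
Qed.

Lemma vanishesD g h : vanishes g -> vanishes h -> vanishes (fun t => g t + h t).
Proof.
move=> Hg Hh eps eps0; have e20 : 0 < eps / 2 by rewrite divr_gt0.
have [T T0 HT] := Hg _ e20; have [S S0 HS] := Hh _ e20.
exists (Num.max T S); first by rewrite le_max T0.
move=> t; rewrite ge_max => /andP[Tt St].
by rewrite (le_trans (ler_normD _ _))// (splitr eps) lerD ?HT ?HS.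
Qed.

Lemma vanishesZ c g : vanishes g -> vanishes (fun t => c * g t).
Proof.
move=> Hg eps eps0; have c0 : 0 < `|c| + 1 by rewrite ltr_wpDl.
have [T T0 HT] := Hg _ (divr_gt0 eps0 c0); exists T => // t Tt.
rewrite normrM (le_trans (ler_wpM2l _ (HT t Tt)))//.
by rewrite mulrA ler_pdivrMr// mulrC ler_wpM2l ?(ltW eps0)// lerDl.
Qed.

Lemma vanishes_le g h : (forall t, 0 <= t -> `|g t| <= h t) -> vanishes h -> vanishes g.
Proof.
move=> gh Hh eps eps0; have [T T0 HT] := Hh eps eps0; exists T => // t Tt.
have t0 := le_trans T0 Tt.
by rewrite (le_trans (gh t t0))// (le_trans (ler_norm _))// HT.
Qed.

Lemma vanishes_eq g h : (forall t, 0 <= t -> g t = h t) -> vanishes h -> vanishes g.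
Proof.
move=> gh Hh eps eps0; have [T T0 HT] := Hh eps eps0; exists T => // t Tt.
by rewrite gh ?HT// (le_trans T0).
Qed.

Lemma ler_Rintegral g h a b : continuous g -> continuous h ->
  (forall s, a <= s -> s <= b -> g s <= h s) ->
  \int[mu]_(s in `[a, b]) g s <= \int[mu]_(s in `[a, b]) h s.
Proof.
move=> cg ch gh; apply: le_Rintegral => //; [exact: continuous_integrable_itv|
  exact: continuous_integrable_itv|].
by move=> s /=; rewrite in_itv/= => /andP[]; exact: gh.
Qed.

Lemma Rintegral_itv_ge0 g a b : (forall s, a <= s -> s <= b -> 0 <= g s) ->
  0 <= \int[mu]_(s in `[a, b]) g s.
Proof.
by move=> g0; apply: Rintegral_ge0 => s /=; rewrite in_itv/= => /andP[]; exact: g0.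
Qed.

(** Choose S where the integral over [0, S] is within [eps] of the supremum of all of them; no later
    integral can gain more than [eps]. *)
Lemma bounded_Rintegral_tail g C : continuous g -> (forall t, 0 <= t -> 0 <= g t) ->
  (forall t, 0 <= t -> \int[mu]_(s in `[0, t]) g s <= C) ->
  forall eps, 0 < eps -> exists2 S, 0 <= S &
    forall t, S <= t -> \int[mu]_(s in `[S, t]) g s <= eps.
Proof.
move=> cg g0 gC eps eps0.
pose A := [set \int[mu]_(s in `[0, t]) g s | t in [set t : R | 0 <= t]].
have supA : has_sup A.
  split; first by exists (\int[mu]_(s in `[0, 0]) g s), 0 => /=.
  by exists C => _ [t t0 <-]; exact: gC.
have [_ [S S0 <-] HS] := sup_adherent eps0 supA.
exists S => // t St; have t0 := le_trans S0 St.
have : \int[mu]_(s in `[0, t]) g s <= sup A by apply: ub_le_sup; [exact: supA.2|exists t].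
rewrite (@Rintegral_chasles _ g 0 S t)//; last exact: continuous_integrable_itv.
by move=> H; lra.
Qed.

Context (e : R -> R).
Context (ce : continuous e) (e_gt0 : forall t, 0 < e t)
  (e_le : forall s t, 0 <= s -> s <= t -> e s <= e t)
  (e_infty : vanishes (fun t => (e t)^-1)).

(** Cut at S: the part over [0, S] is a constant divided by e(t), which tends to infinity, and the
    hypothesis bounds the rest by [eps]. *)
Lemma weighted_average_vanishes r : continuous r ->
  (forall t, 0 <= t -> 0 <= r t) ->
  (forall eps, 0 < eps -> exists2 S, 0 <= S &
    forall t, S <= t -> \int[mu]_(s in `[S, t]) r s <= eps * e t) ->
  vanishes (fun t => (e t)^-1 * \int[mu]_(s in `[0, t]) r s).
Proof.
move=> cr r0 H eps eps0; have e20 : 0 < eps / 2 by rewrite divr_gt0.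
have [S S0 HS] := H _ e20.
have [T T0 HT] := vanishesZ (\int[mu]_(s in `[0, S]) r s) e_infty e20.
exists (Num.max S T); first by rewrite le_max S0.
move=> t; rewrite ge_max => /andP[St Tt].
rewrite (@Rintegral_chasles _ r 0 S t)//; last exact: continuous_integrable_itv.
rewrite mulrDr (le_trans (ler_normD _ _))// (splitr eps) lerD//.
  by rewrite mulrC HT.
rewrite ger0_norm.
  by rewrite mulrC ler_pdivrMr ?HS.
rewrite mulr_ge0 ?invr_ge0 ?(ltW (e_gt0 _))// Rintegral_itv_ge0// => s Ss _.
by rewrite r0// (le_trans S0).
Qed.

(** On [S, t] the weight is at most e(t), which cancels the prefactor and leaves a small tail of the
    integral of [g]. *)
Lemma weighted_average_of_integrable g C : continuous g -> (forall t, 0 <= t -> 0 <= g t) ->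
  (forall t, 0 <= t -> \int[mu]_(s in `[0, t]) g s <= C) ->
  vanishes (fun t => (e t)^-1 * \int[mu]_(s in `[0, t]) (e s * g s)).
Proof.
move=> cg g0 gC; apply: weighted_average_vanishes.
- exact: continuous_funM.
- by move=> t t0; rewrite mulr_ge0 ?g0// ltW.
- move=> eps eps0; have [S S0 HS] := bounded_Rintegral_tail cg g0 gC eps0.
  exists S => // t St; apply: (@le_trans _ _ (\int[mu]_(s in `[S, t]) (e t * g s))).
    apply: ler_Rintegral; [exact: continuous_funM|exact: continuous_funZ|].
    move=> s Ss st; have s0 := le_trans S0 Ss.
    by rewrite ler_wpM2r ?g0// e_le.
  rewrite RintegralZl//; last exact: continuous_integrable_itv.
  by rewrite mulrC ler_wpM2r ?HS// ltW.
Qed.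

(** A Cesaro argument: beyond S the integral is at most eps (e(t) - e(S)), since [de] is the
    derivative of the weight. *)
Lemma weighted_average_of_vanishing (de g : R -> R) : continuous de -> continuous g ->
  (forall t, 0 <= t -> 0 <= de t) -> (forall t : R, 0 < t -> is_derive t (1 : R) e (de t)) ->
  vanishes g ->
  vanishes (fun t => (e t)^-1 * \int[mu]_(s in `[0, t]) (de s * `|g s|)).
Proof.
move=> cde cg de0 De vg; apply: weighted_average_vanishes.
- by apply: continuous_funM => //; exact: continuous_fun_norm.
- by move=> t t0; rewrite mulr_ge0 ?de0.
- move=> eps eps0; have [S S0 HS] := vg eps eps0; exists S => // t St.
  apply: (@le_trans _ _ (\int[mu]_(s in `[S, t]) (eps * de s))).
    apply: ler_Rintegral; [|exact: continuous_funZ|].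
      by apply: continuous_funM => //; exact: continuous_fun_norm.
    move=> s Ss st; have s0 := le_trans S0 Ss.
    by rewrite mulrC ler_wpM2r ?de0 ?HS.
  rewrite RintegralZl//; last exact: continuous_integrable_itv.
  have -> : \int[mu]_(s in `[S, t]) de s = e t - e S.
    by apply: Rintegral_FTC2 => // s Ss _; apply: De; exact: le_lt_trans Ss.
  by rewrite ler_wpM2l ?(ltW eps0)// lerBlDr lerDl ltW.
Qed.

End weighted_averages.

(** * The equivalence for the system freed of the rough forcing *)

Section asymptotics.
Set Implicit Arguments. Unset Strict Implicit.
Context {R : realType}.
Notation mu := (@lebesgue_measure R).

Section integrating_factor_growth.
Context (p : R -> R).
Context (cp : continuous p) (p_ge0 : forall t, 0 <= t -> 0 <= p t).

Lemma integrating_factor_le s t : 0 <= s -> s <= t ->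
  integrating_factor p s <= integrating_factor p t.
Proof.
move=> s0 st; have t0 := le_trans s0 st.
rewrite ler_expR; apply: ler_wpM2l; first by rewrite invr_ge0.
rewrite (clampE _ s0) (clampE _ t0).
rewrite (@Rintegral_chasles _ p 0 s t)//; last exact: continuous_integrable_itv.
by rewrite lerDl Rintegral_itv_ge0// => z sz _; rewrite p_ge0// (le_trans s0).
Qed.

Lemma integrating_factor_infty :
  (forall M, exists2 T, 0 <= T & M <= \int[mu]_(s in `[0, T]) p s) ->
  vanishes (fun t => (integrating_factor p t)^-1).
Proof.
(* With exp(z) >= 1 + z, an integral of at least 2 / eps already gives e(T) >= 1 / eps. *)
move=> Ip eps eps0; have [T T0 HT] := Ip (2 * eps^-1).
exists T => // t Tt; have ip0 s : 0 < integrating_factor p s by exact: expR_gt0.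
rewrite ger0_norm ?invr_ge0 ?(ltW (ip0 _))// invf_ple ?posrE//.
apply: le_trans (integrating_factor_le T0 Tt).
rewrite /integrating_factor clampE//; apply: le_trans (expR_ge1Dx _).
by rewrite ler_wpDl// mulrC ler_pdivlMr// mulrC.
Qed.

End integrating_factor_growth.

Context (w : R) (p dp x u y : R -> R).
Context (w0 : 0 < w) (cp : continuous p) (cdp : continuous dp)
  (cx : continuous x) (cu : continuous u) (cy : continuous y).
Context (Dp : forall t : R, 0 < t -> is_derive t (1 : R) p (dp t))
  (Dx : forall t : R, 0 < t -> is_derive t (1 : R) x (u t + y t))
  (Du : forall t : R, 0 < t -> is_derive t (1 : R) u
     (- (w ^+ 2 * x t) - p t * u t + (w ^+ 2 - p t) * y t)).
Context (x0 : x 0 = 0) (u0 : u 0 = 0).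

Let q t := p t * p t / 4 + dp t / 2.

Context (p_ge0 : forall t, 0 <= t -> 0 <= p t).
Context (Ip : forall M, exists2 T, 0 <= T & M <= \int[mu]_(s in `[0, T]) p s).
Context (C : R) (Iq : forall t, 0 <= t -> \int[mu]_(s in `[0, t]) `|q s| <= C).
Context (vy : vanishes y).

Let e := integrating_factor p.
Let ce : continuous e := continuous_integrating_factor cp.
Let e_gt0 t : 0 < e t. Proof. exact: expR_gt0. Qed.
Let e_le s t : 0 <= s -> s <= t -> e s <= e t := @integrating_factor_le p cp p_ge0 s t.
Let e_infty : vanishes (fun t => (e t)^-1) := integrating_factor_infty cp p_ge0 Ip.
Let cq : continuous q := continuous_damping_defect cp cdp.
Let caq : continuous (fun s => `|q s|) := continuous_fun_norm cq.
Let cay : continuous (fun s => `|y s|) := continuous_fun_norm cy.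
Let cax : continuous (fun s => `|x s|) := continuous_fun_norm cx.
Let cqx : continuous (fun s => `|q s| * `|x s|) := continuous_funM caq cax.
Let cpy : continuous (fun s => p s * `|y s|) := continuous_funM cp cay.

Let main t := \int[mu]_(s in `[0, t]) (Efun p t s * L1 w t s * y s).
Let damped_y t := (e t)^-1 * \int[mu]_(s in `[0, t]) (e s * (p s * `|y s|)).
Let damped_qx t := (e t)^-1 * \int[mu]_(s in `[0, t]) (e s * (`|q s| * `|x s|)).

(** The remainder of [duhamel_formula] is estimated with |sin| <= 1, and p/2 is replaced by p. *)
Lemma sub_main_le t : 0 <= t -> `|x t - main t| <= w^-1 * (damped_qx t + damped_y t).
Proof.
move=> t0; rewrite (duhamel_formula w0 cp cdp cx cu cy Dp Dx Du x0 u0 t0).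
rewrite -/(main t) addrAC subrr add0r normrM.
rewrite ger0_norm ?invr_ge0 ?(ltW (e_gt0 _))//.
rewrite /damped_qx /damped_y -mulrDr mulrCA ler_wpM2l ?invr_ge0 ?(ltW (e_gt0 _))//.
have c1 : continuous (fun s => e s * (`|q s| * `|x s|)) := continuous_funM ce cqx.
have c2 : continuous (fun s => e s * (p s * `|y s|)) := continuous_funM ce cpy.
rewrite -RintegralD//; [|exact: continuous_integrable_itv..].
rewrite -RintegralZl//; last first.
  by apply: continuous_integrable_itv; exact: continuous_funD.
apply: normr_Rintegral_le.
- apply: continuous_integrable_itv; apply: (continuous_funM ce); apply: continuous_funM.
    move=> z; apply: cvgM; last exact: cvg_cst.
    exact: (@continuous_rotation _ w sin t (@continuous_sin R)).
  apply: (continuous_funB (continuous_funM cq cx)).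
  apply: (fun H => continuous_funM H cy) => z.
  by apply: cvgM; [exact: cp|exact: cvg_cst].
- by apply: continuous_integrable_itv; apply: continuous_funZ; exact: continuous_funD.
- move=> s s0 st; rewrite normrM (gtr0_norm (e_gt0 s)) -mulrDr [leRHS]mulrCA.
  rewrite ler_wpM2l ?(ltW (e_gt0 _))// normrM; apply: ler_pM => //.
    rewrite normrM normfV (gtr0_norm w0) ler_piMl ?invr_ge0 ?(ltW w0)//.
    by rewrite ler_norml sin_geN1 sin_le1.
  apply: (le_trans (ler_normB _ _)); rewrite !normrM lerD//.
  rewrite ler_wpM2r// (ger0_norm (p_ge0 s0)) normfV ger0_norm//.
  by rewrite ler_pdivrMr// ler_peMr ?p_ge0// ler1n.
Qed.

Lemma damped_y_vanishes : vanishes damped_y.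
Proof.
have cde : continuous (fun s => 2^-1 * p s * e s).
  by apply: (fun H => continuous_funM H ce); exact: continuous_funZ.
(* The factor 2 compensates e' = p e / 2, so that the weight is exactly the derivative of [e]. *)
have : vanishes (fun t => 2 * ((e t)^-1 *
    \int[mu]_(s in `[0, t]) (2^-1 * p s * e s * `|y s|))).
  apply: vanishesZ.
  apply: (@weighted_average_of_vanishing _ e ce e_gt0 e_infty
    (fun s => 2^-1 * p s * e s) y cde cy _ _ vy).
  - by move=> t t0; rewrite mulr_ge0 ?(ltW (e_gt0 _))// mulr_ge0// p_ge0.
  - by move=> t t0; exact: is_derive_integrating_factor.
apply: vanishes_eq => t t0; rewrite /damped_y mulrCA; congr (_ * _).
rewrite -RintegralZl//; last first.
  by apply: continuous_integrable_itv; exact: (continuous_funM cde cay).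
by apply: eq_Rintegral => s _; field.
Qed.

Lemma damped_qx_vanishes M : (forall t, 0 <= t -> `|x t| <= M) -> vanishes damped_qx.
Proof.
move=> xM; have M0 : 0 <= M := le_trans (normr_ge0 _) (xM 0 (lexx 0)).
apply: (@weighted_average_of_integrable _ e ce e_gt0 e_le e_infty _ (M * C)) => //.
move=> t t0; apply: (@le_trans _ _ (\int[mu]_(s in `[0, t]) (M * `|q s|))).
  apply: ler_Rintegral => //; first exact: continuous_funZ.
  by move=> s s0 _; rewrite mulrC ler_wpM2r ?xM.
by rewrite RintegralZl ?ler_wpM2l ?Iq//; exact: continuous_integrable_itv.
Qed.

Lemma sub_main_vanishes M : (forall t, 0 <= t -> `|x t| <= M) ->
  vanishes (fun t => x t - main t).
Proof.
move=> xM; apply: (vanishes_le sub_main_le); apply: vanishesZ.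
by apply: vanishesD; [exact: (damped_qx_vanishes xM)|exact: damped_y_vanishes].
Qed.

(** This cruder bound, from e(s) <= e(t), serves before [x] is known to be bounded. *)
Lemma damped_qx_le t : 0 <= t ->
  damped_qx t <= \int[mu]_(s in `[0, t]) (`|q s| * `|x s|).
Proof.
move=> t0; rewrite ler_pdivrMl//.
apply: (@le_trans _ _ (\int[mu]_(s in `[0, t]) (e t * (`|q s| * `|x s|)))).
  apply: ler_Rintegral; [exact: (continuous_funM ce cqx)|exact: continuous_funZ|].
  by move=> s s0 st; apply: ler_wpM2r; [exact: mulr_ge0|exact: e_le].
by rewrite RintegralZl; [|by []|exact: continuous_integrable_itv].
Qed.

(* On a tail where [\int |q|] is small, the running maximum of [|x|] absorbs its
   own contribution. *)
Lemma bounded_of_main_vanishes : vanishes main ->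
  exists M, forall t, 0 <= t -> `|x t| <= M.
Proof.
move=> vm.
have w20 : 0 < w / 2 by rewrite divr_gt0.
(* The three tolerances 1, w and w/2 are chosen so that, after division by w where [sub_main_le]
   requires it, they contribute 1, 1 and |x(c)|/2. *)
have [S1 S10 H1] := vm 1 ltr01.
have [S2 S20 H2] := damped_y_vanishes w0.
have [S3 S30 H3] := bounded_Rintegral_tail caq (fun t _ => normr_ge0 (q t)) Iq w20.
pose S := Num.max S1 (Num.max S2 S3).
have S1S : S1 <= S by rewrite le_max lexx.
have S2S : S2 <= S by rewrite !le_max lexx orbT.
have S3S : S3 <= S by rewrite !le_max lexx !orbT.
have S0 : 0 <= S := le_trans S10 S1S.
have [X X0 HX] := @continuous_bounded_itv _ x 0 S cx.
pose K := w^-1 * (X * C).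
exists (Num.max X (2 * (2 + K))) => t t0.
(* The estimate is applied at a maximum point [c] of |x| on [0, t] instead of at [t]: there |x(c)|
   dominates |x| on all of [S, c]. If c <= S, the compact bound [X] suffices. *)
have [c + cmax] := @EVT_max _ (fun s => `|x s|) 0 t t0 (continuous_subspaceT cax).
rewrite in_itv/= => /andP[c0 ct].
have tc : `|x t| <= `|x c| by apply: cmax; rewrite in_itv/= t0 lexx.
rewrite le_max; have [cS|Sc] := leP c S.
  by rewrite (le_trans tc)// HX.
apply/orP; right; apply: (le_trans tc).
have Sc' := ltW Sc.
have Hm : `|main c| <= 1 by apply: H1; exact: le_trans Sc'.
have Hy : damped_y c <= w.
  by rewrite (le_trans (ler_norm _))// H2// (le_trans S2S).
have HqS : \int[mu]_(s in `[0, S]) (`|q s| * `|x s|) <= X * C.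
  apply: (@le_trans _ _ (\int[mu]_(s in `[0, S]) (X * `|q s|))).
    apply: ler_Rintegral => //; first exact: continuous_funZ.
    by move=> s s0 sS; rewrite mulrC ler_wpM2r ?HX.
  rewrite RintegralZl; [|by []|exact: continuous_integrable_itv].
  by rewrite ler_wpM2l ?(ltW X0) ?Iq.
have HqT : \int[mu]_(s in `[S, c]) (`|q s| * `|x s|) <= `|x c| * (w / 2).
  apply: (@le_trans _ _ (\int[mu]_(s in `[S, c]) (`|x c| * `|q s|))).
    apply: ler_Rintegral => //; first exact: continuous_funZ.
    move=> s Ss sc; rewrite mulrC ler_wpM2r//; apply: cmax.
    by rewrite in_itv/= (le_trans S0 Ss) (le_trans sc).
  rewrite RintegralZl; [|by []|exact: continuous_integrable_itv].
  rewrite ler_wpM2l//; apply: (@le_trans _ _ (\int[mu]_(s in `[S3, c]) `|q s|)).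
    rewrite (@Rintegral_chasles _ (fun s => `|q s|) S3 S c)//; last first.
      exact: continuous_integrable_itv.
    by rewrite lerDr Rintegral_itv_ge0.
  by rewrite H3// (le_trans S3S).
have := damped_qx_le c0.
rewrite (@Rintegral_chasles _ _ 0 S c)//; last exact: continuous_integrable_itv.
move=> Hq.
have Hq' : damped_qx c + damped_y c <= X * C + `|x c| * (w / 2) + w.
  by rewrite lerD// (le_trans Hq)// lerD.
have := sub_main_le c0.
have wi : 0 <= w^-1 by rewrite invr_ge0 ltW.
move=> /le_trans/(_ (ler_wpM2l wi Hq')).
have -> : w^-1 * (X * C + `|x c| * (w / 2) + w) = K + `|x c| / 2 + 1.
  by rewrite /K; field; rewrite gt_eqF.
move=> Hx; have : `|x c| <= `|x c - main c| + `|main c|.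
  by rewrite -[in leLHS](subrK (main c) (x c)) ler_normD.
(* Here d = |x(c)|: from d <= k + d/2 + 2 the half is absorbed on the left, which is the origin of
   the bound 2 (2 + K). *)
have absorb (a b d k : R) :
    a <= k + d / 2 + 1 -> d <= a + b -> b <= 1 -> d <= 2 * (2 + k).
  by move=> ? ? ?; lra.
by move/(absorb _ _ _ _ Hx); apply.
Qed.

Lemma vanishes_iff_main : vanishes x <-> vanishes main.
Proof.
split=> [vx|vm].
  have [S S0 HS] := vx 1 ltr01.
  have [X X0 HX] := @continuous_bounded_itv _ x 0 S cx.
  have xM t : 0 <= t -> `|x t| <= Num.max X 1.
    move=> t0; rewrite le_max; have [tS|/ltW St] := leP t S; first by rewrite HX.
    by rewrite (HS t St) orbT.
  have vd := vanishesZ (-1) (sub_main_vanishes xM).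
  by apply: vanishes_eq (vanishesD vx vd) => t _; ring.
have [M xM] := bounded_of_main_vanishes vm.
by apply: vanishes_eq (vanishesD vm (sub_main_vanishes xM)) => t _; ring.
Qed.

End asymptotics.

(** * From improper integrals to integrals over [0, T] *)

Section improper_integrals.
Set Implicit Arguments. Unset Strict Implicit.
Context {R : realType}.
Notation mu := (@lebesgue_measure R).

(** Otherwise the nondecreasing primitive would be bounded and converge to its supremum, and the
    fundamental theorem on the half-line would give the improper integral a finite value. *)
Lemma Rintegral_unbounded (g : R -> R) : continuous g -> (forall t, 0 <= t -> 0 <= g t) ->
  (\int[mu]_(t in `[0%R, +oo[) (g t)%:E)%E = +oo%E ->
  forall M, exists2 T, 0 <= T & M <= \int[mu]_(s in `[0, T]) g s.
Proof.
move=> cg g0 goo M; apply: contrapT => H.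
have bd T : 0 <= T -> \int[mu]_(s in `[0, T]) g s <= M.
  by move=> T0; have [|/ltW MT] := leP (\int[mu]_(s in `[0, T]) g s) M => //;
    exfalso; apply: H; exists T.
pose F := clamp (fun z => \int[mu]_(s in `[0, z]) g s).
have cF : continuous F.
  by apply: continuous_clamp_Rintegral => T _; exact: continuous_integrable_itv.
have Fl : F t @[t --> +oo] --> sup (range F).
  apply: nondecreasing_cvgr.
    move=> s t st; rewrite /F /clamp.
    have m0 z : 0 <= Num.max 0 z :> R by rewrite le_max lexx.
    rewrite (@Rintegral_chasles _ g 0 (Num.max 0 s) (Num.max 0 t))//.
    - by rewrite lerDl Rintegral_itv_ge0// => z sz _; rewrite g0// (le_trans (m0 s)).
    - by rewrite ge_max m0/= le_max st orbT.
    - exact: continuous_integrable_itv.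
  by exists M => _ [t _ <-]; apply: bd; rewrite le_max lexx.
have dF (t : R) : 0 < t -> is_derive t (1 : R) F (g t).
  by move=> t0; apply: is_derive_clamp => //; exact: is_derive_Rintegral.
have := @ge0_continuous_FTC2y _ g F 0 (sup (range F)).
rewrite goo; have : (+oo != (sup (range F))%:E - (F 0)%:E)%E by [].
move=> /eqP ne H2; apply: ne; apply: H2 => //.
- exact: continuous_subspaceT.
- by move=> t t0; case: (dF t t0).
- exact/cvg_at_right_filter/cF.
- by move=> t; rewrite in_itv/= andbT => t0; rewrite derive1E; case: (dF t t0).
Qed.

Lemma Rintegral_le_improper (g : R -> R) : continuous g -> (forall t, 0 <= t -> 0 <= g t) ->
  (\int[mu]_(t in `[0%R, +oo[) (g t)%:E < +oo)%E ->
  forall t, 0 <= t ->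
  \int[mu]_(s in `[0, t]) g s <= fine (\int[mu]_(t in `[0%R, +oo[) (g t)%:E)%E.
Proof.
move=> cg g0 goo t t0; apply: fine_le.
- apply: integrable_fin_num => //; exact: continuous_integrable_itv.
- rewrite ge0_fin_numE//; apply: integral_ge0 => s /=; rewrite in_itv/= andbT => s0.
  by rewrite lee_fin g0.
- apply: ge0_subset_integral => //.
  + apply/measurable_EFinP.
    exact: (subspace_continuous_measurable_fun _ (continuous_subspaceT cg)).
  + by move=> s /=; rewrite in_itv/= andbT => s0; rewrite lee_fin g0.
  + by move=> s /=; rewrite !in_itv/= => /andP[->].
Qed.

End improper_integrals.

(** * Regularity of [y1] and its integral equation *)

Section auxiliary_functions.
Set Implicit Arguments. Unset Strict Implicit.
Context {R : realType}.
Notation mu := (@lebesgue_measure R).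

Lemma eq_clamp (F G : R -> R) : (forall t, 0 <= t -> F t = G t) -> clamp F = clamp G.
Proof. by move=> FG; apply/funext => t; rewrite /clamp FG// le_max lexx. Qed.

Lemma Efun_clamp (p : R -> R) t s : 0 <= s -> Efun (clamp p) t s = Efun p t s.
Proof.
move=> s0; rewrite /Efun; congr (expR (- (_ * _))).
apply: eq_Rintegral => z; rewrite inE/= in_itv/= => /andP[sz _].
by rewrite clampE// (le_trans s0).
Qed.

Lemma vanishes_clamp (F : R -> R) : vanishes (clamp F) <-> vanishes F.
Proof. by split; apply: vanishes_eq => t t0; rewrite clampE. Qed.

Context (w : R) (f : R -> R).
Context (fi : forall T, 0 <= T -> mu.-integrable `[0, T] (EFin \o f)).

(** Splitting exp(-w^2 (t - s)) makes [y1] a smooth factor [phi] times the primitive [G] of an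
    integrable function, the form required by [Rintegral_product_rule]. *)
Let phi s := expR (- w ^+ 2 * s).
Let g s := expR (w ^+ 2 * s) * f s.
Let G := clamp (fun t => \int[mu]_(s in `[0, t]) g s).

Let cphi : continuous phi.
Proof.
move=> z; apply: continuous_comp; last exact: continuous_expR.
by apply: cvgM; [exact: cvg_cst|exact: cvg_id].
Qed.

Let gi T : 0 <= T -> mu.-integrable `[0, T] (EFin \o g).
Proof.
move=> T0; apply: integrable_itvMl; last exact: fi.
move=> z; apply: continuous_comp; last exact: continuous_expR.
by apply: cvgM; [exact: cvg_cst|exact: cvg_id].
Qed.

Let cG : continuous G.
Proof. by apply: continuous_clamp_Rintegral => T /ltW; exact: gi. Qed.

Let y1E t : 0 <= t -> y1 w f t = phi t * G t.
Proof.
move=> t0; rewrite /y1 /G clampE// -RintegralZl//; last exact: gi.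
apply: eq_Rintegral => s _; rewrite /g /phi mulrA -expRD; congr (expR _ * _); ring.
Qed.

Lemma continuous_clamp_y1 : continuous (clamp (y1 w f)).
Proof.
rewrite (eq_clamp y1E); apply: continuous_clamp => T T0.
exact/continuous_subspaceT/continuous_funM.
Qed.

(** The integrated form of y1' = f - w^2 y1, to be subtracted from the integral equation of x'. *)
Lemma y1_integral_equation t : 0 <= t ->
  y1 w f t = \int[mu]_(s in `[0, t]) (f s - w ^+ 2 * clamp (y1 w f) s).
Proof.
move=> t0; rewrite y1E//.
have dphi (s : R) : is_derive s (1 : R) phi (- w ^+ 2 * phi s).
  have ds := is_derive_scale (- w ^+ 2) (is_derive_id s (1 : R)).
  rewrite mulr1 in ds; rewrite mulrC.
  exact: (@is_derive1_comp _ expR (fun z : R => - w ^+ 2 * z) s _ _ (is_derive_expR _) ds).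
rewrite (@Rintegral_product_rule _ phi (fun s => - w ^+ 2 * phi s) g G t)//.
- apply: eq_Rintegral => s; rewrite inE/= in_itv/= => /andP[s0 st].
  rewrite clampE// y1E// /g mulrA -expRD.
  have -> : - w ^+ 2 * s + w ^+ 2 * s = 0 by ring.
  by rewrite expR0; ring.
- exact: continuous_funZ.
- exact: gi.
- by move=> s s0 st; rewrite /G clampE.
Qed.

End auxiliary_functions.

(** * Reduction of the original problem to the clamped system *)

Theorem mainTheorem8 (R : realType) (w : R) (p f x : R -> R) :
  0 < w ->
  (forall t, 0 <= t -> derivable p t 1) ->
  {within `[0, +oo[, continuous (derive1 p)} ->
  (forall t, 0 <= t -> 0 < p t) ->
  (forall t, 0 <= t -> derive1 p t < 0) ->
  (\int[@lebesgue_measure R]_(t in @nonneg_half_line R) (p t)%:E)%E = +oo%E ->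
  ((\int[@lebesgue_measure R]_(t in @nonneg_half_line R) (p t ^+ 2)%:E) < +oo)%E ->
  (forall T, 0 <= T -> (@lebesgue_measure R).-integrable `[0, T] (EFin \o f)) ->
  solves_ivp p w f x 0 0 ->
  (y1 w f t @[t --> +oo] --> 0) ->
  ((x t @[t --> +oo] --> 0) <->
   ((\int[@lebesgue_measure R]_(s in `[0, t]) (Efun p t s * L1 w t s * y1 w f s))
      @[t --> +oo] --> 0)).
Proof.
move=> w0 dp cdp p0 dp0 ipoo ip2 fi [v [cv [x0 [v0 [xE vE]]]]] y10.
have half T : `[0, T]%classic `<=` (`[0, +oo[%classic : set R).
  by move=> s /=; rewrite !in_itv/= => /andP[->].
pose P := clamp p; pose dP := clamp (derive1 p); pose V := clamp v.
pose Y := clamp (y1 w f); pose X := clamp x.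
have cP : continuous P.
  apply: continuous_clamp => T T0; apply: derivable_within_continuous => s.
  by rewrite in_itv/= => /andP[s0 _]; exact: dp.
have cdP : continuous dP.
  by apply: continuous_clamp => T T0; apply: continuous_subspaceW cdp; exact: half.
have cV : continuous V.
  by apply: continuous_clamp => T T0; apply: continuous_subspaceW cv; exact: half.
have cY : continuous Y by exact: continuous_clamp_y1.
have XE : X = clamp (fun z => \int[@lebesgue_measure R]_(s in `[0, z]) V s).
  apply: eq_clamp => t t0; rewrite xE// add0r; apply: eq_Rintegral => s.
  by rewrite inE/= in_itv/= => /andP[s0 _]; rewrite /V clampE.
have cX : continuous X.
  rewrite XE; apply: continuous_clamp_Rintegral => T _.
  exact: continuous_integrable_itv.
pose U t := V t - Y t.
have cU : continuous U by exact: continuous_funB.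
pose k t := - (w ^+ 2 * X t) - P t * U t + (w ^+ 2 - P t) * Y t.
have cPV : continuous (fun t => P t * V t) by exact: continuous_funM.
have ck : continuous k.
  apply: continuous_funD.
    apply: continuous_funB; last exact: continuous_funM.
    by move=> z; apply: cvgN; exact: (continuous_funZ cX).
  by apply: continuous_funM => // z; apply: cvgB; [exact: cvg_cst|exact: cP].
(* In the difference of the integral equations of [v] and [y1] the function [f] cancels; the
   remaining integrand [k] is continuous, so [U] is differentiable at every t > 0. *)
have UE : U = clamp (fun z => \int[@lebesgue_measure R]_(s in `[0, z]) k s).
  rewrite /U /V /Y; apply/funext => t; rewrite /clamp.
  have : 0 <= Num.max 0 t by rewrite le_max lexx.
  move: (Num.max 0 t) => {}t t0.
  rewrite vE// add0r (@y1_integral_equation _ w f fi t t0).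
  have iY : (@lebesgue_measure R).-integrable `[0, t] (EFin \o (fun s => f s - w ^+ 2 * Y s)).
    apply: integrable_itvB; first exact: fi.
    by apply: continuous_integrable_itv; exact: continuous_funZ.
  have iV : (@lebesgue_measure R).-integrable `[0, t]
      (EFin \o (fun s => f s - P s * V s - w ^+ 2 * X s)).
    apply: integrable_itvB; last first.
      by apply: continuous_integrable_itv; exact: continuous_funZ.
    apply: integrable_itvB; first exact: fi.
    exact: continuous_integrable_itv.
  have -> : \int[@lebesgue_measure R]_(s in `[0, t]) (f s - p s * v s - w ^+ 2 * x s) =
      \int[@lebesgue_measure R]_(s in `[0, t]) (f s - P s * V s - w ^+ 2 * X s).
    apply: eq_Rintegral => s; rewrite inE/= in_itv/= => /andP[s0 _].
    by rewrite /P /V /X !clampE.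
  rewrite -RintegralB//; apply: eq_Rintegral => s _.
  by rewrite /k /U -/Y; ring.
have DP (t : R) : 0 < t -> is_derive t (1 : R) P (dP t).
  move=> t0; apply: is_derive_clamp => //; rewrite /dP clampE ?ltW//.
  by rewrite derive1E; apply: DeriveDef => //; apply: dp; exact: ltW.
have DX (t : R) : 0 < t -> is_derive t (1 : R) X (U t + Y t).
  move=> t0; rewrite /U subrK XE; apply: is_derive_clamp => //.
  exact: is_derive_Rintegral.
have DU (t : R) : 0 < t -> is_derive t (1 : R) U (k t).
  by move=> t0; rewrite UE; apply: is_derive_clamp => //; exact: is_derive_Rintegral.
have X0 : X 0 = 0 by rewrite /X clampE.
have U0 : U 0 = 0.
  by rewrite UE clampE// set_itv1 Rintegral_set1.
have P0 t : 0 <= t -> 0 <= P t by move=> t0; rewrite /P clampE// ltW// p0.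
have IP : forall M, exists2 T, 0 <= T & M <= \int[@lebesgue_measure R]_(s in `[0, T]) P s.
  apply: Rintegral_unbounded => //; rewrite -ipoo.
  apply: eq_integral => s; rewrite inE ?/nonneg_half_line/= in_itv/= andbT => s0.
  by rewrite /P clampE.
have cPP : continuous (fun s => P s * P s) by exact: continuous_funM.
have IP2 : exists C, forall t, 0 <= t -> \int[@lebesgue_measure R]_(s in `[0, t]) (P s * P s) <= C.
  eexists; apply: (@Rintegral_le_improper _ (fun s => P s * P s)) => //.
    by move=> t t0; rewrite mulr_ge0// P0.
  move: ip2; congr (_ < _)%E; apply: eq_integral => s.
  by rewrite inE ?/nonneg_half_line/= in_itv/= andbT => s0; rewrite /P clampE.
have [C HC] := IP2.
pose q t := P t * P t / 4 + dP t / 2.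
have cq : continuous q by exact: continuous_damping_defect.
(* As p' < 0, |q| <= p^2/4 - p'/2. The first term contributes at most C/4, the second (P(0) -
   P(t))/2 <= P(0)/2. *)
have Iq t : 0 <= t -> \int[@lebesgue_measure R]_(s in `[0, t]) `|q s| <= C / 4 + P 0 / 2.
  move=> t0.
  have c1 : continuous (fun s => 4^-1 * (P s * P s)) by exact: continuous_funZ.
  have c2 : continuous (fun s => 2^-1 * dP s) by exact: continuous_funZ.
  apply: (@le_trans _ _ (\int[@lebesgue_measure R]_(s in `[0, t])
      (4^-1 * (P s * P s) - 2^-1 * dP s))).
    apply: ler_Rintegral; [exact: continuous_fun_norm|exact: continuous_funB|].
    move=> s s0 _; apply: (le_trans (ler_normD _ _)).
    rewrite ger0_norm; last by rewrite divr_ge0// mulr_ge0// P0.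
    rewrite ler0_norm; last by rewrite pmulr_lle0 ?invr_gt0// /dP clampE// ltW// dp0.
    by rewrite ![_ / _]mulrC.
  rewrite RintegralB//; [|exact: continuous_integrable_itv..].
  rewrite !RintegralZl//; [|exact: continuous_integrable_itv..].
  have -> : \int[@lebesgue_measure R]_(s in `[0, t]) dP s = P t - P 0.
    by apply: Rintegral_FTC2 => // s s0 _; exact: DP.
  have := HC t t0; have := P0 t t0; move: (P t) (P 0) (Rintegral _ _ _) => a b c; lra.
have vY : vanishes Y by apply/vanishes_clamp/cvg_vanishesP.
have := vanishes_iff_main w0 cP cdP cX cU cY DP DX DU X0 U0 P0 IP Iq vY.
rewrite !cvg_vanishesP -(@vanishes_clamp _ x) -/X => ->.
have mainE t : 0 <= t -> \int[@lebesgue_measure R]_(s in `[0, t]) (Efun P t s * L1 w t s * Y s) =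
    \int[@lebesgue_measure R]_(s in `[0, t]) (Efun p t s * L1 w t s * y1 w f s).
  move=> t0; apply: eq_Rintegral => s; rewrite inE/= in_itv/= => /andP[s0 _].
  by rewrite (@Efun_clamp _ p t s s0) [Y s]clampE.
by split; apply: vanishes_eq => t t0; rewrite mainE.
Qed.
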